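(* For every $p\in\mathbb{N}$, each of the following problems, on inputs with parameter $n$ and independence number (resp. stability number) at most $\alpha$, can be solved by a $p$-pass deterministic streaming algorithm using $O(\alpha n^{1+1/p})$ space in the insertion-only model and $O(\alpha n^{1+O(1/\sqrt{p})})$ space in the turnstile model: (i) computing a topological ordering of an $n$-node directed acyclic graph; (ii) computing the strongly connected component decomposition of an $n$-node digraph; (iii) computing a minimum chain cover of an $n$-node directed acyclic graph; (iv) computing a satisfying assignment (or reporting none exists) of an $n$-variable 2-SAT formula.
   Context: All digraphs are simple; the independence number of a digraph is that of its underlying undirected graph. A chain of a digraph $G$ is a sequence of nodes forming a directed path in the transitive closure of $G$ (the digraph with an arc $(u,v)$ iff $G$ has a directed $u$–$v$ path); a chain cover is a collection of chains partitioning the node set, and a minimum chain cover has the fewest chains. The implication graph $G_F$ of a 2-SAT formula $F$ on $n$ variables has nodes $x$ and $\neg x$ for each variable $x$, and for each clause $(\ell\vee\ell')$ the arcs $(\neg\ell,\ell')$ and $(\neg\ell',\ell)$; the stability number of $F$ is the independence number of $G_F$. For 2-SAT the stream consists of the clauses (equivalently the arcs of $G_F$). Graph streaming model: arcs arrive in adversarial order, $p$ forward passes; insertion-only model has only insertions, turnstile allows deletions of previously inserted items. Space upper bounds are in words of $O(\log n)$ bits. *)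

(* Defs.v *)
From HB Require Import structures.
From mathcomp Require Import all_boot all_order all_algebra.
From mathcomp Require Import all_classical all_reals exp.

Set Implicit Arguments.
Unset Strict Implicit.
Unset Printing Implicit Defensive.

(** ** Digraphs *)

Definition digraph (V : finType) := {set V * V}.

Section Digraph.
Variables (V : finType) (G : digraph V).

Definition arc : rel V := [rel u v | (u, v) \in G].

Definition underlying : rel V := [rel u v | arc u v || arc v u].

Definition independent (S : {set V}) : bool :=
  [forall u in S, forall v in S, (u != v) ==> ~~ underlying u v].

Definition independence_number : nat :=
  \max_(S : {set V} | independent S) #|S|.

Definition acyclic : Prop := forall c : seq V, ucycle arc c -> c = [::].

(* [connect arc] is reflexive; the transitive closure is a simple digraph, so
   loops are left out. *)
Definition transitive_closure : digraph V :=
  [set e | (e.1 != e.2) && connect arc e.1 e.2].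

Definition topological_order (t : seq V) : Prop :=
  perm_eq t (enum V) /\ forall u v, arc u v -> index u t < index v t.

Definition strong_component (u : V) : {set V} :=
  [set v | connect arc u v && connect arc v u].

Definition strong_components : {set {set V}} :=
  [set strong_component u | u : V].

End Digraph.

Definition chain (V : finType) (G : digraph V) (c : seq V) : bool :=
  uniq c && sorted (arc (transitive_closure G)) c.

Definition chain_cover (V : finType) (G : digraph V) (cs : seq (seq V)) : bool :=
  [&& all (chain G) cs, [::] \notin cs & perm_eq (flatten cs) (enum V)].

Definition minimum_chain_cover (V : finType) (G : digraph V)
    (cs : seq (seq V)) : Prop :=
  chain_cover G cs /\ forall ds, chain_cover G ds -> size cs <= size ds.

(** ** 2-SAT *)

(* [(x, true)] is the literal x and [(x, false)] its negation. *)
Definition literal (n : nat) : finType := ('I_n * bool)%type.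

Definition neg (n : nat) (l : literal n) : literal n := (l.1, ~~ l.2).

(* A clause (l \/ l') is the set {l, l'}; l = l' is allowed. *)
Definition is_clause (n : nat) (c : {set literal n}) : bool :=
  [exists l, exists l', c == [set l; l']].

(* As digraphs are simple, the loops that a clause (l \/ ~ l) would create
   are left out, and parallel arcs are merged. *)
Definition implication_graph (n : nat) (F : {set {set literal n}}) :
    digraph (literal n) :=
  [set e | (e.1 != e.2) && ([set neg e.1; e.2] \in F)].

Definition stability_number (n : nat) (F : {set {set literal n}}) : nat :=
  independence_number (implication_graph F).

Definition satisfies (n : nat) (a : {ffun 'I_n -> bool})
    (F : {set {set literal n}}) : bool :=
  [forall c in F, exists l in c, a l.1 == l.2].

(** ** Streams *)

Inductive stream_model := InsertionOnly | Turnstile.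

(* [(true, x)] inserts x and [(false, x)] deletes x. *)
Definition update (T : Type) : Type := (bool * T)%type.

(* s is a stream of admissible items whose final content is X: no deletion
   ever removes an item that is not present, and in the end each element of X
   is present exactly once and nothing else is present. *)
Definition is_stream (M : stream_model) (T : finType) (admissible : pred T)
    (X : {set T}) (s : seq (update T)) : Prop :=
  [/\ forall u, u \in s -> admissible u.2,
      M = InsertionOnly -> forall u, u \in s -> u.1 = true,
      forall k x, count_mem (false, x) (take k s)
                  <= count_mem (true, x) (take k s)
    & forall x, count_mem (true, x) s = count_mem (false, x) s + (x \in X)].

(** ** Multi-pass deterministic streaming algorithms *)

(* A word has floor(log2 n) + 1 bits, so it holds any number 0, ..., n. *)
Definition word (n : nat) : Type := ((trunc_log 2 n).+1).-tuple bool.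

Definition memory (n S : nat) : Type := S.-tuple (word n).

(* Only the memory content is carried over from one stream item to the next
   and from one pass to the next. The [nat] argument of [process] and of
   [end_pass] is the index of the current pass. *)
Record algorithm (Mem Item Ans : Type) := Algorithm {
  start : Mem;
  process : nat -> Mem -> update Item -> Mem;
  end_pass : nat -> Mem -> Mem;
  output : Mem -> Ans
}.

Definition run_pass (Mem Item Ans : Type) (A : algorithm Mem Item Ans)
    (s : seq (update Item)) (m : Mem) (i : nat) : Mem :=
  end_pass A i (foldl (process A i) m s).

Definition run (Mem Item Ans : Type) (A : algorithm Mem Item Ans) (p : nat)
    (s : seq (update Item)) : Ans :=
  output A (foldl (run_pass A s) (start A) (iota 0 p)).

(** ** Problems *)

(* An input with parameter n is a finite set of items. [promise] is the class
   of inputs considered and [parameter] its independence or stability number. *)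
Record problem := Problem {
  item : nat -> finType;
  answer : nat -> Type;
  admissible : forall n, pred (item n);
  promise : forall n, {set item n} -> Prop;
  parameter : forall n, {set item n} -> nat;
  correct : forall n, {set item n} -> answer n -> Prop
}.

Definition digraph_problem (ans : nat -> Type)
    (prom : forall n, digraph 'I_n -> Prop)
    (corr : forall n, digraph 'I_n -> ans n -> Prop) : problem :=
  @Problem (fun n => ('I_n * 'I_n)%type) ans
    (fun n e => e.1 != e.2) prom
    (fun n G => independence_number G) corr.

Definition topological_ordering_problem : problem :=
  @digraph_problem (fun n => seq 'I_n)
    (fun n G => acyclic G) (fun n G t => topological_order G t).

Definition scc_problem : problem :=
  @digraph_problem (fun n => {set {set 'I_n}})
    (fun n G => True) (fun n G P => P = strong_components G).

Definition minimum_chain_cover_problem : problem :=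
  @digraph_problem (fun n => seq (seq 'I_n))
    (fun n G => acyclic G) (fun n G cs => minimum_chain_cover G cs).

Definition two_sat_problem : problem :=
  @Problem (fun n => {set literal n}) (fun n => option {ffun 'I_n -> bool})
    (fun n c => is_clause c) (fun n F => True)
    (fun n F => stability_number F)
    (fun n F r => match r with
                  | Some a => satisfies a F
                  | None => forall a, ~~ satisfies a F
                  end).

(* That X has admissible items only follows from [is_stream]. *)
Definition solvable_in_space (R : realType) (M : stream_model) (P : problem)
    (p n alpha : nat) (space : R) : Prop :=
  exists S : nat, (S%:R <= space)%R /\
  exists A : algorithm (memory n S) (item P n) (answer P n),
  forall (X : {set item P n}) (s : seq (update (item P n))),
    promise X -> parameter X <= alpha ->
    is_stream M (@admissible P n) X s ->
    correct X (run A p s).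

(* Main.v *)
From HB Require Import structures.
From mathcomp Require Import all_boot all_order all_algebra.
From mathcomp Require Import all_classical all_reals exp.
From mathcomp Require Import zify ring lra.
From mathcomp Require Import fintype finset.
Require Import Defs.

Set Implicit Arguments.
Unset Strict Implicit.
Unset Printing Implicit Defensive.

(* All four answers are functions of the transitive closure of a digraph whose
   arcs are carried by the stream items, so it suffices to stream that closure.

   The nodes are split into blocks of k^l nodes, l = 0, 1, ..., and the closure
   of the digraph induced on each block is computed level by level. Since a
   block has independence number at most alpha, its closure is a preorder
   without antichains of more than alpha elements, hence by Dilworth's theorem
   a union of alpha chains; it is stored by the least element that each node
   reaches on each chain. To merge k blocks it is enough to know, for each
   node, each of the k blocks and each chain of it, the first out-neighbour of
   the node on the chain: all further ones are reachable from it.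

   With insertions only, these minima are found in one pass with one word each,
   so k = n^(1/p) gives alpha n^(1 + 1/p) words. With deletions, a minimum is
   found in q passes by k-ary search, with k counters that need to be correct
   only modulo a number exceeding the final counts; q = sqrt p passes for each
   of q levels with k = n^(1/q) use alpha n k^2 words. *)

(** * Width of finite preorders *)

Section Preorder.
Variables (V : finType) (T : rel V).
Hypotheses (Tr : reflexive T) (Tt : transitive T).

(** The size of the down-set. Along a chain, comparing these sizes recovers the preorder; ties are
    equivalent elements. *)
Definition rank (v : V) : nat := #|[set x | T x v]|.

(** If [T v u], the down-set of [v] lies in that of [u] and is at least as large, so the two
    coincide and contain [u]. *)
Lemma rank_comparable (u v : V) : T u v || T v u -> rank u <= rank v -> T u v.
Proof.
case/orP=> // vu le_uv; have: [set x | T x v] == [set x | T x u].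
  rewrite eqEcard le_uv andbT; apply/subsetP => x; rewrite !inE => xv.
  exact: Tt xv vu.
by move/eqP/setP/(_ u); rewrite !inE Tr.
Qed.

Lemma rank_lt (v : V) : rank v < #|V|.+1.
Proof. by rewrite ltnS max_card. Qed.

Definition antichain (S : {set V}) : bool :=
  [forall u in S, forall v in S, T u v ==> (u == v)].

Lemma antichainP (S : {set V}) :
  reflect (forall u v, u \in S -> v \in S -> T u v -> u = v) (antichain S).
Proof.
apply: (iffP forall_inP) => [h u v uS vS uv|h u uS].
  by have /forall_inP/(_ v vS)/implyP/(_ uv)/eqP := h u uS.
by apply/forall_inP => v vS; apply/implyP => uv; apply/eqP; apply: h.
Qed.

Definition chain_coloring (A : {set V}) (m : nat) (c : V -> nat) : Prop :=
  (forall v, v \in A -> c v < m) /\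
  (forall u v, u \in A -> v \in A -> c u = c v -> T u v || T v u).

(** By pigeonhole: [c] is injective on [Y], since elements of one colour are comparable. *)
Lemma chain_coloring_full (A Y : {set V}) (m : nat) (c : V -> nat) :
  chain_coloring A m c -> Y \subset A -> antichain Y -> #|Y| = m ->
  forall i, i < m -> exists2 y, y \in Y & c y = i.
Proof.
move=> [cm cc] /subsetP YA /antichainP aY cY i im.
have m0 : 0 < m by apply: leq_ltn_trans im.
pose f (v : V) : 'I_m := insubd (Ordinal m0) (c v).
have fE v : v \in Y -> f v = c v :> nat by move=> vY; rewrite val_insubd cm ?YA.
have finj : {in Y &, injective f}.
  move=> u v uY vY /(congr1 val) /=; rewrite !fE // => cuv.
  by case/orP: (cc _ _ (YA _ uY) (YA _ vY) cuv) => /aY ->.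
have: f @: Y == [set: 'I_m].
  by rewrite eqEcard subsetT cardsT card_ord card_in_imset // cY leqnn.
move/eqP/setP/(_ (Ordinal im)); rewrite in_setT => /imsetP [y yY e].
by exists y => //; rewrite -fE // -e.
Qed.

Lemma chain_top (Z : {set V}) (z0 : V) :
  z0 \in Z -> (forall u v, u \in Z -> v \in Z -> T u v || T v u) ->
  exists2 x, x \in Z & forall z, z \in Z -> T z x.
Proof.
move=> z0Z cmp; case: (arg_maxnP rank z0Z) => x xZ xmax.
by exists x => // z zZ; apply: rank_comparable; [exact: cmp | exact: xmax].
Qed.

(* Galvin's proof of Dilworth's theorem, which works verbatim for preorders. *)
Lemma dilworth (A : {set V}) (m : nat) :
  (forall S : {set V}, S \subset A -> antichain S -> #|S| <= m) ->
  exists c, chain_coloring A m c.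
Proof.
have [n] := ubnP #|A|; elim: n A m => // n IH A m; rewrite ltnS => An wA.
have [->|[a0 a0A]] := set_0Vmem A.
  by exists (fun=> 0); split=> [v|u v]; rewrite inE.
case: (@arg_maxnP _ a0 (fun v => v \in A) rank a0A) => a aA amax.
have atop x : x \in A -> T a x -> T x a.
  move=> xA ax; apply: rank_comparable; first by rewrite ax orbT.
  exact: amax.
have m_gt0 : 0 < m.
  rewrite -(cards1 a); apply: wA; first by rewrite sub1set.
  by apply/antichainP => u v; rewrite !inE => /eqP -> /eqP ->.
(* It suffices to split off a chain whose removal decreases the width. *)
have split_chain (K : {set V}) : a \in K ->
    (forall u v, u \in K -> v \in K -> T u v || T v u) ->
    (forall S : {set V}, S \subset A :\: K -> antichain S -> #|S| <= m.-1) ->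
    exists c, chain_coloring A m c.
  move=> aK Kc wK.
  have ltK : #|A :\: K| < n.
    apply: leq_trans An; apply: proper_card; apply/properP; split.
      exact: subsetDl.
    by exists a => //; rewrite inE aK.
  have [c [cm cc]] := IH _ _ ltK wK.
  exists (fun v => if v \in K then m.-1 else c v); split=> [v vA|u v uA vA].
    case: ifP => vK; first by rewrite prednK.
    by rewrite -(prednK m_gt0) ltnS ltnW // cm // inE vK.
  case: ifP => uK; case: ifP => vK; first by move=> _; exact: Kc.
  - by move=> e; have := cm v; rewrite inE vK vA -e ltnn => /(_ isT).
  - by move=> e; have := cm u; rewrite inE uK uA e ltnn => /(_ isT).
  by move=> e; apply: cc => //; rewrite inE ?uK ?vK.
pose A' := A :\ a.
(* If [A'] has no antichain of [m] elements, the chain to remove is [a] alone. *)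
case: (boolP [exists S : {set V}, [&& S \subset A', antichain S & #|S| == m]]);
    last first.
  move=> noS; apply: (split_chain [set a]); first by rewrite inE.
    by move=> u v; rewrite !inE => /eqP -> /eqP ->; rewrite Tr.
  move=> S SA aS; rewrite -ltnS prednK // ltn_neqAle; apply/andP; split.
    by move/existsPn/(_ S): noS; rewrite SA aS.
  by apply: wA aS; apply: subset_trans SA (subsetDl _ _).
case/existsP=> Y0 /and3P [Y0A aY0 /eqP cY0].
have A'A : A' \subset A by exact: subsetDl.
have ltA' : #|A'| < n.
  by apply: leq_trans An; rewrite [X in _ < X](cardsD1 a) aA.
have [c cc] := IH A' m ltA' (fun S SA => wA S (subset_trans SA A'A)).
(* The elements of colour [i] that lie on some antichain of [m] elements of [A']; [x i] below is a
   top of this chain. *)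
pose Z i := [set z in A' | (c z == i) &&
  [exists S : {set V}, [&& S \subset A', antichain S, #|S| == m & z \in S]]].
have Zin (S : {set V}) z : S \subset A' -> antichain S -> #|S| = m -> z \in S ->
    z \in Z (c z).
  move=> SA aS cS zS; rewrite inE (subsetP SA) // eqxx /=.
  by apply/existsP; exists S; rewrite SA aS cS eqxx.
have /choice [x xP] : forall i : 'I_m, exists x,
    x \in Z i /\ forall z, z \in Z i -> T z x.
  move=> i; have [y yY0 cy] := chain_coloring_full cc Y0A aY0 cY0 (ltn_ord i).
  have yZ : y \in Z i by rewrite -cy; exact: Zin yY0.
  have [|x xZ xtop] := chain_top yZ; last by exists x.
  move=> u v; rewrite !inE => /andP [uA /andP [/eqP cu _]].
  move=> /andP [vA /andP [/eqP cv _]]; apply: cc.2; rewrite ?inE //.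
  by rewrite cu cv.
have xA' i : x i \in A' by have [] := xP i; rewrite inE => /andP [].
have cx i : c (x i) = i.
  by have [] := xP i; rewrite inE => /andP [_ /andP [/eqP]].
(* An antichain of [m] elements through [x j] has an element [y] of colour [i], which is below
   [x i]. Then [T (x i) (x j)] gives [T y (x j)], so [y = x j] and the colours agree. *)
have xanti i j : T (x i) (x j) -> i = j.
  move=> xij; apply/eqP; apply: contraT => nij.
  have [] := xP j; rewrite inE => /andP [_ /andP [_ /existsP [S]]].
  case/and4P=> SA aS /eqP cS xjS _.
  have [y yS cy] := chain_coloring_full cc SA aS cS (ltn_ord i).
  have yx : T y (x i) by apply: (xP i).2; rewrite -cy; exact: Zin yS.
  have e : y = x j by move/antichainP: aS; apply => //; exact: Tt yx xij.
  by move: nij; rewrite -val_eqE /= -cy e cx eqxx.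
(* If some [x i] is below [a], remove [a] and the elements of colour [i] below [x i]. An antichain
   of [m] remaining elements would meet [Z i], which has been removed entirely. *)
case: (boolP [exists i, T (x i) a]) => [/existsP [i xia]|nx].
  apply: (split_chain (a |: [set z in A' | (c z == i) && T z (x i)])).
  - by rewrite !inE eqxx.
  - move=> u v; rewrite !inE => /orP [/eqP -> | ] .
      case/orP=> [/eqP ->|/and3P [_ _ vx]]; first by rewrite Tr.
      by rewrite (Tt vx xia) orbT.
    case/and3P=> uA /eqP cu ux; case/orP=> [/eqP ->|].
      by rewrite (Tt ux xia).
    case/and3P=> vA /eqP cv vx; apply: cc.2; rewrite ?inE //.
    by rewrite cu cv.
  move=> S SA aS.
  have SA' : S \subset A'.
    apply: subset_trans SA _; apply/subsetP => z; rewrite !inE negb_or.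
    by case/andP=> /andP [-> _] ->.
  rewrite -ltnS prednK // ltn_neqAle; apply/andP; split; last first.
    by apply: wA aS; apply: subset_trans SA' A'A.
  apply/eqP => cS.
  have [y yS cy] := chain_coloring_full cc SA' aS cS (ltn_ord i).
  have yx : T y (x i) by apply: (xP i).2; rewrite -cy; exact: Zin yS.
  have := subsetP SA y yS; have := subsetP SA' y yS.
  by rewrite !inE cy eqxx yx /= => ->; rewrite orbT.
(* Otherwise [a] and the [x i] form an antichain of [m.+1] elements, which is too many. *)
have axi i : ~~ T (x i) a by move/existsPn: nx.
have aX : a \notin [set x i | i : 'I_m].
  by apply/imsetP => -[i _ e]; have := axi i; rewrite -e Tr.
have: #|a |: [set x i | i : 'I_m]| <= m.
  apply: wA.
    rewrite subUset sub1set aA; apply/subsetP => _ /imsetP [i _ ->].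
    exact: (subsetP A'A).
  apply/antichainP => u v; rewrite !inE => /orP [/eqP ->|/imsetP [i _ ->]].
    case/orP=> [/eqP -> //|/imsetP [j _ ->]] axj.
    by have := axi j; rewrite atop // (subsetP A'A).
  case/orP=> [/eqP ->|/imsetP [j _ ->]]; last by move/xanti ->.
  by rewrite (negbTE (axi i)).
rewrite cardsU1 aX card_imset ?card_ord ?add1n ?ltnn // => i j e.
by apply: xanti; rewrite e.
Qed.

End Preorder.

(** * Minimum of a streamed multiset *)

Lemma foldl_iotaS (S : Type) (f : S -> nat -> S) (x : S) (j : nat) :
  foldl f x (iota 0 j.+1) = f (foldl f x (iota 0 j)) j.
Proof. by rewrite -addn1 iotaD foldl_cat. Qed.

(* [f] is the final multiset and the output [m] reports that it is empty. *)
Definition finds_min (M : stream_model) (W : Type) (m N q : nat)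
    (F : algorithm W 'I_m nat) : Prop :=
  forall (s : seq (update 'I_m)) (f : 'I_m -> nat),
    (M = InsertionOnly -> forall u, u \in s -> u.1) ->
    (forall r, count_mem (true, r) s = count_mem (false, r) s + f r) ->
    \sum_r f r <= N ->
    (forall r, 0 < f r -> run F q s <= r) /\
    (run F q s = m \/ exists2 r, 0 < f r & run F q s = r).

(** The initial value [ord_max] is [m], above every item, and so reports emptiness. *)
Definition insertion_finder (m : nat) : algorithm 'I_m.+1 'I_m nat :=
  Algorithm (@ord_max m)
    (fun _ t (u : update 'I_m) => if u.2 < t then widen_ord (leqnSn m) u.2 else t)
    (fun _ t => t) (@nat_of_ord _).

Lemma insertion_finderP (m N : nat) :
  finds_min InsertionOnly N 1 (insertion_finder m).
Proof.
move=> s f ins cnt _; pose P := process (insertion_finder m) 0.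
rewrite -[run _ _ _]/(nat_of_ord (foldl P ord_max s)).
have inv t : [/\ foldl P t s <= t,
    forall u, u \in s -> foldl P t s <= u.2
  & foldl P t s = t \/ exists2 u, u \in s & foldl P t s = u.2 :> nat].
  elim: s t {ins cnt} => [|u s IH] t /=; first by split=> //; left.
  have [le1 le2 eq3] := IH (P t u).
  have [Pt Pu] : P t u <= t /\ P t u <= u.2.
    by rewrite /P /=; case: ifP => [/ltnW //|]; rewrite /= ltnNge => /negbFE.
  split; first exact: leq_trans le1 Pt.
    move=> x; rewrite inE => /orP [/eqP ->|]; last exact: le2.
    exact: leq_trans le1 Pu.
  case: eq3 => [->|[x xs ->]]; last first.
    by right; exists x => //; rewrite inE xs orbT.
  rewrite /P /=; case: ifP => _; last by left.
  by right; exists u => //; rewrite inE eqxx.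
have fP r : (0 < f r) = ((true, r) \in s).
  rewrite -has_pred1 has_count cnt.
  suff -> : count_mem (false, r) s = 0 by [].
  apply/count_memPn; apply/negP => /ins.
  by move=> /(_ (erefl _)).
have [_ le2 eq3] := inv (@ord_max m); split.
  by move=> r; rewrite fP => /le2.
case: eq3 => [-> | [[b r] us e]]; first by left.
right; exists r => //; rewrite fP.
by have := ins (erefl _) _ us; rewrite /= => bt; rewrite -bt.
Qed.

(** * Minimum search under deletions *)

Section SearchFinder.
Variables (b m N q : nat).

(* Before pass [j] the state holds the quotient of the minimum by
   [b ^ (q - j)]; during the pass, counters modulo [N.+1] are kept for the [b]
   subintervals of the corresponding interval. *)
Definition search_state : finType :=
  (option 'I_m.+1 * {ffun 'I_b.+1 -> 'I_N.+1})%type.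

(** In base [b.+1], the leading digits of [r] are those found before pass [j], and the next digit is
    [i]. The value [None] stands for an empty multiset. *)
Definition in_slot (j : nat) (a : option 'I_m.+1) (i : 'I_b.+1) (r : nat) :
    bool :=
  if a is Some a0 then
    (r %/ b.+1 ^ (q - j) == a0) && ((r %/ b.+1 ^ (q - j.+1)) %% b.+1 == i)
  else false.

(** Adding [N] subtracts one modulo [N.+1]. *)
Definition count_update (sg : bool) (c : 'I_N.+1) : 'I_N.+1 :=
  inord ((c + (if sg then 1 else N)) %% N.+1).

Definition first_nonzero (ct : {ffun 'I_b.+1 -> 'I_N.+1}) : option 'I_b.+1 :=
  [pick i | (0 < ct i) && [forall i' : 'I_b.+1, (i' < i) ==> (ct i' == ord0)]].

Definition search_finder : algorithm search_state 'I_m.+1 nat :=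
  Algorithm (Some ord0, [ffun=> ord0])
    (fun j w (u : update 'I_m.+1) => (w.1, [ffun i => if in_slot j w.1 i u.2
                                   then count_update u.1 (w.2 i) else w.2 i]))
    (fun j w => (if w.1 is Some a0 then
                   if first_nonzero w.2 is Some i then
                     insub (a0 * b.+1 + i) else None
                 else None, [ffun=> ord0]))
    (fun w => if w.1 is Some a0 then nat_of_ord a0 else m.+1).

Lemma search_count (j : nat) (s : seq (update 'I_m.+1)) (w : search_state) :
  let w' := foldl (process search_finder j) w s in
  w'.1 = w.1 /\ forall i, w'.2 i =
    (w.2 i + count (fun u : update 'I_m.+1 => u.1 && in_slot j w.1 i u.2) s
           + N * count (fun u : update 'I_m.+1 => ~~ u.1 && in_slot j w.1 i u.2) s) %% N.+1 :> nat.
Proof.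
elim: s w => [|u s IH] w /=.
  by split=> // i; rewrite muln0 !addn0 modn_small.
have [-> cnt] := IH (w.1, [ffun i => if in_slot j w.1 i u.2
                                   then count_update u.1 (w.2 i) else w.2 i]).
split=> // i; rewrite cnt /= ffunE.
case: ifP => slot; last by rewrite !andbF.
rewrite !andbT /count_update inordK ?ltn_pmod // -addnA modnDml.
by congr (_ %% _); case: u.1 => /=; lia.
Qed.

Lemma count_by_value (P : pred 'I_m.+1) (s : seq (update 'I_m.+1)) (sg : bool) :
  count (fun u : update 'I_m.+1 => (u.1 == sg) && P u.2) s = \sum_(r | P r) count_mem (sg, r) s.
Proof.
elim: s => [|[sg' r'] s IH] /=; first by rewrite big1.
rewrite IH big_split /=; congr addn.
transitivity (\sum_(r | P r) ((sg' == sg) && (r == r'))%N).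
  case: (sg' == sg) => /=; last by rewrite big1.
  rewrite big_mkcond (bigD1 r') //= eqxx big1 ?addn0 => [|r /negbTE ->].
    by case: (P r').
  by case: (P r).
by apply: eq_bigr => r _; rewrite xpair_eqE (eq_sym r').
Qed.

(** Counters may wrap around during the pass, but the final difference of insertions and deletions
    is at most [N], so its residue determines it. *)
Lemma search_pass (j : nat) (s : seq (update 'I_m.+1)) (f : 'I_m.+1 -> nat)
    (a : option 'I_m.+1) :
  (forall r, count_mem (true, r) s = count_mem (false, r) s + f r) ->
  \sum_r f r <= N ->
  forall i, (foldl (process search_finder j) (a, [ffun=> ord0]) s).2 i =
    \sum_(r : 'I_m.+1 | in_slot j a i r) f r :> nat.
Proof.
move=> cnt fN i; have [_ ->] := search_count j s (a, [ffun=> ord0]).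
rewrite /= ffunE /= add0n.
pose slot sg (u : update 'I_m.+1) := (u.1 == sg) && in_slot j a i u.2.
rewrite (eq_count (a2 := slot true)); last by case=> [[] r].
rewrite [X in N * X](eq_count (a2 := slot false)); last by case=> [[] r].
rewrite !(count_by_value (fun r : 'I_m.+1 => in_slot j a i r)).
under eq_bigr => r _ do rewrite cnt.
rewrite big_split /=; set x := (X in X + _ + _); set y := (X in _ + X + _).
have -> : x + y + N * x = x * N.+1 + y by rewrite mulnS mulnC addnAC.
rewrite modnMDl modn_small // ltnS; apply: leq_trans fN.
by rewrite [leqRHS](bigID (fun r : 'I_m.+1 => in_slot j a i r)) leq_addr.
Qed.

Lemma search_finderP (M : stream_model) :
  0 < q -> m.+1 <= b.+1 ^ q -> finds_min M N q search_finder.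
Proof.
move=> q0 mb s f _ cnt fN.
pose st j := foldl (run_pass search_finder s) (start search_finder) (iota 0 j).
have stS j : st j.+1 = run_pass search_finder s (st j) j.
  exact: foldl_iotaS.
have st2 j : (st j).2 = [ffun=> ord0] by case: j => [|j]; rewrite ?stS.
have pass j : [/\ (foldl (process search_finder j) (st j) s).1 = (st j).1 &
  forall i, (foldl (process search_finder j) (st j) s).2 i =
            \sum_(r : 'I_m.+1 | in_slot j (st j).1 i r) f r :> nat].
  have [e _] := search_count j s (st j); split=> // i.
  by rewrite [st j]surjective_pairing st2; apply: search_pass.
rewrite -[run _ _ _]/(output search_finder (st q)).
case: (boolP [exists r, 0 < f r]) => [/existsP [r0 fr0]|/existsPn f0]; last first.
  split=> [r|]; first by rewrite (negbTE (f0 r)).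
  (* With an empty final multiset the last pass ends with zero counters, so the state becomes
     [None], which is output as [m.+1]. *)
  left; case: q q0 => // j _; rewrite stS /=; have [-> ctE] := pass j.
  case: ((st j).1) ctE => [a|] // ctE.
  rewrite /first_nonzero; case: pickP => // i /andP [].
  by rewrite ctE big1 // => r _; apply/eqP; rewrite -leqn0 leqNgt.
case: (@arg_minnP _ r0 (fun r => 0 < f r) (@nat_of_ord _) fr0) => t ft tmin.
(* Each pass appends one digit of the minimum [t]. *)
suff inv j : j <= q -> omap (@nat_of_ord _) (st j).1 = Some (t %/ b.+1 ^ (q - j)).
  have := inv q (leqnn q); rewrite /= subnn expn0 divn1.
  case: (st q).1 => // a [->]; split=> //.
  by right; exists t.
elim: j => [|j IH] jq.
  by rewrite /= subn0 divn_small //; apply: leq_trans mb.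
rewrite stS /= /run_pass /=; have [-> ctE] := pass j.
have {IH} := IH (ltnW jq).
case: (st j).1 ctE => // a0 ctE [a0E].
set ct := (foldl _ _ _).2 in ctE *; set B := b.+1 ^ (q - j.+1).
have BE : b.+1 ^ (q - j) = B * b.+1 by rewrite -expnSr -subSn.
pose i0 : 'I_b.+1 := inord ((t %/ B) %% b.+1).
have i0E : i0 = (t %/ B) %% b.+1 :> nat by rewrite inordK // ltn_pmod.
have a0E' : a0 = t %/ B %/ b.+1 :> nat by rewrite -divnMA -BE.
have ct0 : 0 < ct i0.
  rewrite ctE (bigD1 t) /=; last by rewrite a0E i0E !eqxx.
  by rewrite addn_gt0 ft.
(* An element in an earlier slot would share the leading digits of [t] and have a smaller next
   digit, contradicting minimality. *)
have ctlt (i : 'I_b.+1) : i < i0 -> ct i = ord0.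
  move=> ii0; apply: val_inj; rewrite /= ctE big1 // => r /andP [/eqP ra /eqP ri].
  apply/eqP; rewrite -leqn0 leqNgt; apply/negP => /tmin tr.
  have := leq_div2r B tr; rewrite (divn_eq (t %/ B) b.+1) (divn_eq (r %/ B) b.+1).
  by rewrite -a0E' -divnMA -BE ra ri leq_add2l -i0E leqNgt ii0.
have -> : first_nonzero ct = Some i0.
  rewrite /first_nonzero; case: pickP => [i|/(_ i0)]; last first.
    rewrite ct0 /= => /negbT/forallPn [i]; rewrite negb_imply.
    by case/andP=> /ctlt ->; rewrite eqxx.
  case/andP=> cti /forallP imin; congr Some; apply: val_inj => /=.
  case: (ltngtP i i0) => // [/ctlt e|lt]; first by move: cti; rewrite e.
  by have := imin i0; rewrite lt /= => /eqP e; move: ct0; rewrite e.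
have tB : t %/ B < m.+1 by exact: leq_ltn_trans (leq_div _ _) (ltn_ord t).
by rewrite i0E a0E' -divn_eq insubT.
Qed.

End SearchFinder.

(** * Streaming the transitive closure *)

Lemma independent_leq (V : finType) (G : digraph V) (S : {set V}) :
  independent G S -> #|S| <= independence_number G.
Proof. by move=> iS; rewrite /independence_number (bigmax_sup S). Qed.

Lemma leq_expl (m n e : nat) : m <= n -> m ^ e <= n ^ e.
Proof. by case: e => // e; rewrite leq_exp2r. Qed.

Lemma connect_mono (V : finType) (e e' : rel V) :
  (forall u v, e u v -> connect e' u v) ->
  forall u v, connect e u v -> connect e' u v.
Proof. by move=> h u v; exact: connect_sub u v. Qed.

Section Closure.
Variables (I V : finType) (item_of : V * V -> I).

(* Both kinds of input are digraphs whose arc [e] is carried by the item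
   [item_of e]; a clause carries two arcs. *)
Definition arc_graph (X : {set I}) : digraph V :=
  [set e | (e.1 != e.2) && (item_of e \in X)].

Variables (k alpha q : nat).
Hypotheses (k_gt0 : 0 < k) (alpha_gt0 : 0 < alpha) (q_gt0 : 0 < q).
Variables (W : finType) (F : algorithm W 'I_#|V|.+1 nat).

Definition block (l : nat) (v : V) : nat := enum_rank v %/ k ^ l.

Definition subblock (l : nat) (v : V) : 'I_k :=
  Ordinal (ltn_pmod (block l v) k_gt0).

Lemma blockS (l : nat) (v : V) : block l.+1 v = block l v %/ k.
Proof. by rewrite /block expnSr divnMA. Qed.

Lemma block_subblock (l : nat) (u v : V) :
  block l.+1 u = block l.+1 v -> subblock l u = subblock l v ->
  block l u = block l v.
Proof.
rewrite !blockS => e /(congr1 val) /= e'.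
by rewrite (divn_eq (block l u) k) e e' -divn_eq.
Qed.

Definition level_arc (G : digraph V) (l : nat) : rel V :=
  [rel u v | arc G u v && (block l u == block l v)].

Lemma level_arcE (G : digraph V) (l : nat) (u v : V) :
  level_arc G l u v = arc G u v && (block l u == block l v).
Proof. by []. Qed.

Lemma level_connect_block (G : digraph V) (l : nat) (u v : V) :
  connect (level_arc G l) u v -> block l u = block l v.
Proof.
case/connectP=> p; elim: p u => [|w p IH] u /=; first by move=> _ ->.
by case/andP=> /andP [_ /eqP ->] /IH{}IH /IH.
Qed.

(* The preorder inside the blocks is stored as a chain colouring [col], a
   monotone rank [rk] along the chains and, for each node and colour, the
   least rank that the node reaches in its block. *)
Definition tables : finType :=
  ({ffun V -> 'I_alpha} * {ffun V -> 'I_#|V|.+1} *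
   {ffun V * 'I_alpha -> 'I_#|V|.+2})%type.

Definition col (tb : tables) : V -> 'I_alpha := tb.1.1.
Definition rk (tb : tables) : V -> 'I_#|V|.+1 := tb.1.2.

(** The entry is a threshold on the chain of [w]; the value [#|V|.+1], above every rank, says that
    the chain is not reached. *)
Definition decode (l : nat) (tb : tables) : rel V :=
  [rel u w | (block l u == block l w) && (tb.2 (u, col tb w) <= rk tb w)].

(** The first clause is what lets a merge keep only first out-neighbours: they reach all later nodes
    of their chain. *)
Definition faithful (l : nat) (T : rel V) (tb : tables) : Prop :=
  (forall u w, block l u = block l w -> col tb u = col tb w ->
     rk tb u <= rk tb w -> T u w) /\
  (forall u w, decode l tb u w = T u w).

(** Within a block every arc is a level arc, so an antichain of [T] is independent in [G].
    Dilworth's theorem then colours each block with [alpha] chains, which [rank] orders. *)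
Lemma faithful_exists (G : digraph V) (l : nat) (T : rel V) :
  independence_number G <= alpha -> T =2 connect (level_arc G l) ->
  exists tb, faithful l T tb.
Proof.
move=> Ga TE.
have Tr : reflexive T by move=> u; rewrite TE connect0.
have Tt : transitive T.
  by move=> v u w; rewrite !TE; exact: connect_trans.
have Tb u v : T u v -> block l u = block l v.
  by rewrite TE; exact: level_connect_block.
have /choice [c cP] : forall b, exists c,
    chain_coloring T [set v | block l v == b] alpha c.
  move=> b; apply: dilworth => // S /subsetP Sb /antichainP aS.
  apply: leq_trans Ga; apply: independent_leq.
  apply/forall_inP => u uS; apply/forall_inP => v vS; apply/implyP => uv.
  have buv : block l u = block l v.
    by have := Sb _ uS; have := Sb _ vS; rewrite !inE => /eqP -> /eqP ->.
  have nT x y : x \in S -> y \in S -> block l x = block l y -> x != y ->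
      ~~ arc G x y.
    move=> xS yS bxy; apply: contra => xy; apply/eqP; apply: aS => //.
    by rewrite TE connect1 // level_arcE xy bxy eqxx.
  by rewrite /underlying /= negb_or !nT // eq_sym.
pose cl v : 'I_alpha := insubd (Ordinal alpha_gt0) (c (block l v) v).
have clP u v : block l u = block l v -> cl u = cl v -> T u v || T v u.
  move=> buv /(congr1 val) /=; rewrite !val_insubd.
  have [cu cc] := cP (block l u).
  rewrite -buv !cu ?inE ?buv ?eqxx // => e.
  by apply: cc; rewrite ?inE ?buv ?eqxx // -buv.
pose rv v : 'I_#|V|.+1 := Ordinal (rank_lt T v).
have rP u v : block l u = block l v -> cl u = cl v -> rv u <= rv v -> T u v.
  by move=> buv cuv; apply: rank_comparable => //; exact: clP.
have /choice [f fP] : forall z : V * 'I_alpha, exists t : 'I_#|V|.+2,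
    forall w, cl w = z.2 -> block l z.1 = block l w -> (t <= rv w) = T z.1 w.
  move=> [u j] /=; case: (boolP [exists w, T u w && (cl w == j)]); last first.
    move/existsPn=> no; exists ord_max => w cw _ /=.
    rewrite leqNgt rank_lt /=; apply/esym/negbTE.
    by have := no w; rewrite cw eqxx andbT.
  case/existsP=> w0 w0P.
  case: (@arg_minnP _ w0 (fun w => T u w && (cl w == j)) (fun w => rv w) w0P).
  move=> w1 /andP [uw1 /eqP cw1] w1min.
  exists (widen_ord (leqnSn _) (rv w1)) => w cw buw /=.
  apply/idP/idP => [le|uw]; last by apply: w1min; rewrite uw cw eqxx.
  by apply: (Tt _ _ _ uw1); apply: rP; rewrite ?cw ?cw1 // -(Tb _ _ uw1).
exists ([ffun v => cl v], [ffun v => rv v], [ffun z => f z]); split=> u w.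
  by rewrite /col /rk /= !ffunE; exact: rP.
rewrite /decode /col /rk /= !ffunE.
case: eqP => [b|/eqP nb] /=; first by rewrite fP.
by apply/esym/negbTE; apply: contra nb => /Tb ->.
Qed.

(** An arbitrary choice suffices, as the model bounds memory and not computation; the default occurs
    only if no faithful table exists. *)
Definition encode (l : nat) (T : rel V) : tables :=
  xget ([ffun=> Ordinal alpha_gt0], [ffun=> ord0], [ffun=> ord0])
    (faithful l T).

Lemma encodeP (G : digraph V) (l : nat) (T : rel V) :
  independence_number G <= alpha -> T =2 connect (level_arc G l) ->
  faithful l (connect (level_arc G l)) (encode l T).
Proof.
move=> Ga TE; have [tb tbP] := faithful_exists Ga TE.
have [h1 h2] : faithful l T (encode l T) by apply: xgetPex; exists tb.
by split=> u w => [b c r|]; rewrite -TE //; exact: h1.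
Qed.

(** One minimum search is run for each node, sub-block and chain in it. *)
Definition cell : finType := (V * 'I_k * 'I_alpha)%type.

Definition cell_target (l : nat) (tb : tables) (z : cell) (w : V) : bool :=
  [&& z.1.1 != w, block l.+1 z.1.1 == block l.+1 w, subblock l w == z.1.2
    & col tb w == z.2].

(** These updates depend only on the item and the stored tables, so the stream of every cell can be
    simulated on the fly. *)
Definition cell_updates (l : nat) (tb : tables) (z : cell) (u : update I) :
    seq (update 'I_#|V|.+1) :=
  [seq (u.1, rk tb w) | w <- enum V &
     cell_target l tb z w && (item_of (z.1.1, w) == u.2)].

Definition cell_stream (l : nat) (tb : tables) (z : cell) (s : seq (update I)) :
    seq (update 'I_#|V|.+1) :=
  flatten [seq cell_updates l tb z u | u <- s].

(** Several nodes may share the minimal rank; ties on a chain of one sub-block reach each other, so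
    arcs to all of them are harmless. *)
Definition merge (l : nat) (tb : tables) (t : cell -> nat) : rel V :=
  connect [rel u w | decode l tb u w ||
    (block l.+1 u == block l.+1 w) &&
    (t (u, subblock l w, col tb w) == rk tb w)].

Definition closure_state : finType := (tables * {ffun cell -> W})%type.

(* Level [l] of the recursion occupies the passes [l * q, ..., l * q + q - 1]. *)
Definition closure_algorithm (p : nat) : algorithm closure_state I (rel V) :=
  Algorithm ((encode 0 eq_op, [ffun=> start F]) : closure_state)
    (fun i st u => (st.1, [ffun z => foldl (process F (i %% q)) (st.2 z)
                                       (cell_updates (i %/ q) st.1 z u)]))
    (fun i st =>
       let cs := [ffun z => end_pass F (i %% q) (st.2 z)] in
       if (i %% q).+1 == q then
         (encode (i %/ q).+1
            (merge (i %/ q) st.1 (fun z => output F (cs z))),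
          [ffun=> start F])
       else (st.1, cs))
    (fun st => decode (p %/ q) st.1).

Lemma closure_process (p i : nat) (s : seq (update I)) (st : closure_state) :
  foldl (process (closure_algorithm p) i) st s =
  (st.1, [ffun z => foldl (process F (i %% q)) (st.2 z)
                      (cell_stream (i %/ q) st.1 z s)]).
Proof.
elim: s st => [|u s IH] st /=.
  rewrite [LHS]surjective_pairing; congr pair; apply/ffunP => z.
  by rewrite ffunE.
rewrite IH /=; congr pair; apply/ffunP => z; rewrite !ffunE.
by rewrite /cell_stream /= foldl_cat.
Qed.

Lemma count_cell_stream (l : nat) (tb : tables) (z : cell) (s : seq (update I))
    (sg : bool) (r : 'I_#|V|.+1) :
  count_mem (sg, r) (cell_stream l tb z s) =
  \sum_(w | cell_target l tb z w && (rk tb w == r))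
     count_mem (sg, item_of (z.1.1, w)) s.
Proof.
elim: s => [|u s IH]; first by rewrite big1.
rewrite /cell_stream /= count_cat -/(cell_stream l tb z s) IH big_split /=.
congr addn; rewrite /cell_updates count_map count_filter -sum1_count.
rewrite big_enum_cond /= big_mkcond [RHS]big_mkcond /=; apply: eq_bigr => w _.
case: u => sg' x /=; rewrite !xpair_eqE (eq_sym x).
by case: cell_target; case: (rk tb w == r); case: (sg' == sg);
   case: (_ == x).
Qed.

Variables (M : stream_model).
Hypothesis Fmin : finds_min M #|V| q F.

Lemma cell_min (adm : pred I) (X : {set I}) (s : seq (update I)) (l : nat)
    (tb : tables) (z : cell) :
  is_stream M adm X s ->
  let t := run F q (cell_stream l tb z s) in
  (forall w, cell_target l tb z w -> arc (arc_graph X) z.1.1 w -> t <= rk tb w)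
  /\ (t = #|V|.+1 \/
      exists2 w, cell_target l tb z w && arc (arc_graph X) z.1.1 w
               & t = rk tb w).
Proof.
case=> _ ins _ cnt /=.
pose f r := \sum_(w | cell_target l tb z w && (rk tb w == r))
  (item_of (z.1.1, w) \in X : nat).
have [] := Fmin (s := cell_stream l tb z s) (f := f).
- move=> Mi u /flattenP [us /mapP [u' u's ->] /mapP [w _ ->]] /=.
  exact: ins.
- move=> r; rewrite !count_cell_stream /f -big_split /=.
  by apply: eq_bigr => w _; exact: cnt.
(* Each node [w] contributes at most one, to the rank [rk tb w] only, so the multiset has at most
   [#|V|] elements. *)
- rewrite /f (exchange_big_dep (cell_target l tb z)) /=; last first.
    by move=> r w _ /andP [].
  apply: leq_trans (_ : \sum_(w : V) 1 <= _); last by rewrite sum1_card.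
  rewrite big_mkcond /=; apply: leq_sum => w _; case: ifP => // tw.
  rewrite (eq_bigl (pred1 (rk tb w))); last by move=> r /=; rewrite tw eq_sym.
  by rewrite big_pred1_eq leq_b1.
have fP r : (0 < f r) = [exists w, [&& cell_target l tb z w, rk tb w == r
                                    & item_of (z.1.1, w) \in X]].
  rewrite lt0n sum_nat_eq0 negb_forall; apply: eq_existsb => w.
  by rewrite negb_imply; case: (_ \in X); rewrite ?andbT ?andbF.
have arcE w : cell_target l tb z w ->
    arc (arc_graph X) z.1.1 w = (item_of (z.1.1, w) \in X).
  by rewrite /arc /= inE /= => /and4P [->].
move=> tle tex; split=> [w tw|].
  rewrite arcE // => wX; apply: tle; rewrite fP; apply/existsP; exists w.
  by rewrite tw wX eqxx.
case: tex => [->|[r]]; first by left.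
rewrite fP => /existsP [w /and3P [tw /eqP <- wX]] ->; right; exists w => //.
by rewrite tw arcE.
Qed.

(** An added arc is an arc of [G] to a first out-neighbour followed by a path along its chain.
    Conversely, the head of an arc of [G] is reached from the first out-neighbour on its chain. *)
Lemma merge_closure (G : digraph V) (l : nat) (tb : tables) (t : cell -> nat) :
  faithful l (connect (level_arc G l)) tb -> (forall u, ~~ arc G u u) ->
  (forall z : cell,
    (forall w, cell_target l tb z w -> arc G z.1.1 w -> t z <= rk tb w) /\
    (t z = #|V|.+1 \/
     exists2 w, cell_target l tb z w && arc G z.1.1 w & t z = rk tb w)) ->
  merge l tb t =2 connect (level_arc G l.+1).
Proof.
move=> [chn dec] irr tP u v; apply/idP/idP; apply: connect_mono => {u v} u v.
- case/orP=> /=.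
    rewrite dec; apply: connect_mono => {u v} u v /andP [uv /eqP b].
    by apply: connect1; rewrite level_arcE uv !blockS b eqxx.
  case/andP=> /eqP buv /eqP tE.
  case: (tP (u, subblock l v, col tb v)).2 => [|[w /andP [] /=]].
    by rewrite tE => e; have := ltn_ord (rk tb v); rewrite e ltnn.
  case/and4P=> /= uw /eqP bw /eqP sw /eqP cw uaw; rewrite tE => re.
  apply: connect_trans (connect1 (_ : level_arc G l.+1 u w)) _.
    by rewrite level_arcE uaw bw eqxx.
  apply: (connect_mono (e := level_arc G l)) => [x y /andP [xy /eqP b]|].
    by apply: connect1; rewrite level_arcE xy !blockS b eqxx.
  apply: chn => //; last by rewrite re.
  by apply: block_subblock => //; rewrite -bw.
- case/andP=> uv /eqP buv.
  have nuv : u != v by apply: contraTneq uv => ->; exact: irr.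
  pose z : cell := (u, subblock l v, col tb v).
  have zv : cell_target l tb z v by rewrite /cell_target /= nuv buv !eqxx.
  have [tle] := tP z; have {tle} := tle v zv uv.
  move=> tle [e|[w /andP [zw uw] tE]].
    by have := leq_ltn_trans tle (ltn_ord _); rewrite e ltnn.
  case/and4P: (zw) => /= _ /eqP bw /eqP sw /eqP cw.
  apply: (@connect_trans _ _ w); apply: connect1 => /=.
    by rewrite bw eqxx sw cw -/z tE eqxx orbT.
  rewrite [decode _ _ _ _]dec chn //; last by rewrite -tE.
  by apply: block_subblock => //; rewrite -bw.
Qed.

(** The tables stay fixed during the [q] passes of a level, so every finder runs on an unchanging
    cell stream. *)
Lemma closure_invariant (adm : pred I) (X : {set I}) (s : seq (update I))
    (p i : nat) :
  is_stream M adm X s -> independence_number (arc_graph X) <= alpha ->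
  exists2 tb, faithful (i %/ q) (connect (level_arc (arc_graph X) (i %/ q))) tb
    & foldl (run_pass (closure_algorithm p) s) (start (closure_algorithm p))
        (iota 0 i) =
      (tb, [ffun z => foldl (run_pass F (cell_stream (i %/ q) tb z s)) (start F)
                        (iota 0 (i %% q))]).
Proof.
move=> strm Xa; elim: i => [|i [tb tbP IH]].
  exists (encode 0 eq_op); last first.
    by rewrite mod0n /=; congr pair; apply/ffunP => z; rewrite !ffunE.
  (* Blocks of level [0] are singletons, so their closure is equality. *)
  rewrite div0n; apply: encodeP => // u v.
  apply/eqP/idP => [->|/level_connect_block]; first exact: connect0.
  by rewrite /block expn0 !divn1 => /val_inj/enum_rank_inj.
rewrite foldl_iotaS IH /run_pass closure_process /=.
set cs := [ffun z => _].
have csE z : cs z = foldl (run_pass F (cell_stream (i %/ q) tb z s)) (start F)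
                      (iota 0 (i %% q).+1).
  by rewrite !ffunE foldl_iotaS.
have iE := divn_eq i q; have iq := ltn_pmod i q_gt0.
case: ifP => [/eqP e|/negbT ne]; last first.
  have lt : (i %% q).+1 < q by rewrite ltn_neqAle ne.
  have [dE mE] : i.+1 %/ q = i %/ q /\ i.+1 %% q = (i %% q).+1.
    rewrite {1 3}iE -addnS divnMDl // (divn_small lt) addn0 modnMDl.
    by rewrite (modn_small lt).
  rewrite dE mE; exists tb => //; congr pair; apply/ffunP => z.
  by rewrite csE [RHS]ffunE.
have [dE mE] : i.+1 %/ q = (i %/ q).+1 /\ i.+1 %% q = 0.
  by rewrite {1 3}iE -addnS e -mulSnr mulnK // modnMl.
rewrite dE mE; eexists; last first.
  congr pair; apply/ffunP => z; rewrite !ffunE; exact: erefl.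
apply: encodeP => //; apply: merge_closure => //.
  by move=> u; rewrite /arc /= inE /= eqxx.
move=> z; rewrite csE e; exact: (cell_min _ _ _ strm).
Qed.

Lemma closure_algorithmP (adm : pred I) (X : {set I}) (s : seq (update I))
    (p : nat) :
  #|V| <= k ^ (p %/ q) ->
  is_stream M adm X s -> independence_number (arc_graph X) <= alpha ->
  run (closure_algorithm p) p s =2 connect (arc (arc_graph X)).
Proof.
move=> kp strm Xa u v; rewrite /run.
have [tb [_ dec] ->] := closure_invariant p p strm Xa.
(* At the final level all nodes are in one block. *)
have b0 w : block (p %/ q) w = 0 by exact: divn_small (leq_trans (ltn_ord _) kp).
rewrite [LHS]dec; apply: eq_connect => {u v} u v.
by rewrite level_arcE !b0 andbT.
Qed.

(** In digits base [#|V|.+2]: a colour, a rank and [alpha] thresholds per node, and [x] digits for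
    each of the [k * alpha] cells of a node. *)
Lemma card_closure_state (x : nat) :
  alpha <= #|V| -> #|W| <= #|V|.+2 ^ x ->
  #|closure_state| <= #|V|.+2 ^ (#|V| * (2 + alpha + x * k * alpha)).
Proof using Type.
clear Fmin q_gt0 k_gt0 alpha_gt0; move=> aV Wx; rewrite !card_prod !card_ffun !card_prod !card_ord.
have -> : #|V| * (2 + alpha + x * k * alpha) =
  #|V| + #|V| + #|V| * alpha + x * (#|V| * k * alpha) by lia.
rewrite !expnD (expnM _ x); apply: leq_mul; last exact: leq_expl.
apply: leq_mul => //; apply: leq_mul; apply: leq_expl; lia.
Qed.

End Closure.

(** * Space *)

(** A word takes at least [n.+1] values because [n < 2 ^ (trunc_log 2 n).+1]. *)
Lemma memory_embedding (n S : nat) (St : finType) (x0 : St) :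
  #|St| <= n.+1 ^ S ->
  exists (f : St -> memory n S) (g : memory n S -> St), cancel f g.
Proof.
move=> le; pose Mt : finType := S.-tuple (((trunc_log 2 n).+1).-tuple bool).
have leM : #|St| <= #|Mt|.
  rewrite !card_tuple card_bool; apply: leq_trans le _.
  by apply: leq_expl; exact: trunc_log_ltn.
exists (fun x => enum_val (widen_ord leM (enum_rank x)) : Mt).
exists (fun y : Mt => if insub (enum_rank y : nat) : option 'I_#|St| is Some i
                      then enum_val i else x0) => x.
by rewrite enum_valK /= valK enum_rankK.
Qed.

Lemma algorithm_transport (St Mem I Ans Ans' : Type) (f : St -> Mem)
    (g : Mem -> St) (h : Ans -> Ans') (A : algorithm St I Ans) :
  cancel f g ->
  exists B : algorithm Mem I Ans', forall p s, run B p s = h (run A p s).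
Proof.
move=> fg; exists (Algorithm (f (start A)) (fun i m u => f (process A i (g m) u))
  (fun i m => f (end_pass A i (g m))) (fun m => h (output A (g m)))) => p s.
set B := Algorithm _ _ _ _.
have procE i st : foldl (process B i) (f st) s = f (foldl (process A i) st s).
  by elim: s st => //= u s IH st; rewrite fg IH.
have passE r st : foldl (run_pass B s) (f st) r = f (foldl (run_pass A s) st r).
  by elim: r st => //= i r IH st; rewrite /run_pass procE /= fg IH.
by rewrite /run passE /= fg.
Qed.

(* The answer and the parameter depend on the transitive closure of a digraph
   on at most [2 * n] nodes whose arcs are carried by the items. *)
Definition closure_determined (P : problem) (n : nat) : Prop :=
  exists (V : finType) (item_of : V * V -> item P n), [/\ #|V| <= 2 * n,
    forall T : rel V, exists a, forall X : {set item P n},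
      (forall x, x \in X -> admissible x) -> promise X ->
      connect (arc (arc_graph item_of X)) =2 T -> correct X a
  & forall X : {set item P n}, (forall x, x \in X -> admissible x) ->
      independence_number (arc_graph item_of X) <= parameter X].

Lemma stream_admissible (M : stream_model) (I : finType) (adm : pred I)
    (X : {set I}) (s : seq (update I)) :
  is_stream M adm X s -> forall x, x \in X -> adm x.
Proof.
case=> admP _ _ cnt x xX; apply: (admP (true, x)).
by rewrite -has_pred1 has_count cnt xX addn1.
Qed.

(** The width bound is lowered to [minn alpha #|V|] so that a colour fits in a word. *)
Lemma closure_solvable (M : stream_model) (P : problem) (n p alpha k q x : nat) :
  closure_determined P n -> 0 < k -> 0 < q -> 2 * n <= k ^ (p %/ q) ->
  (forall N, N <= 2 * n -> exists (W : finType) (F : algorithm W 'I_N.+1 nat),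
     finds_min M N q F /\ #|W| <= N.+2 ^ x) ->
  exists2 S, S <= 2 * (2 * n * ((3 + x * k) * alpha)) &
  exists A : algorithm (memory n S) (item P n) (answer P n),
  forall (X : {set item P n}) (s : seq (update (item P n))),
    promise X -> parameter X <= alpha ->
    is_stream M (@admissible P n) X s -> correct X (run A p s).
Proof.
case=> V [item_of [V2n /choice [ans ansP] parP]] k0 q0 kn /(_ _ V2n).
case=> W [F [Fmin Wx]].
(* A node is an independent set, so here admissible inputs force [V] to be empty; all relations on
   [V] then agree and a constant answer works. *)
have [a0|a_gt0] := posnP (minn alpha #|V|).
  exists 0 => //.
  exists (Algorithm [tuple] (fun _ m _ => m) (fun _ m => m) (fun _ => ans eq_op)).
  move=> X s prX Xa strm; apply: ansP => //; first exact: stream_admissible strm.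
  move=> u; exfalso; move: a0; apply/eqP; rewrite -lt0n leq_min.
  apply/andP; split; last by apply/card_gt0P; exists u.
  apply: leq_trans Xa; apply: leq_trans (parP _ (stream_admissible strm)).
  rewrite -(cards1 u); apply: independent_leq; apply/forall_inP => v.
  rewrite inE => /eqP ->; apply/forall_inP => w; rewrite inE => /eqP ->.
  by rewrite eqxx.
set a := minn _ _ in a_gt0.
have aV : a <= #|V| by exact: geq_minr.
have aalpha : a <= alpha by exact: geq_minl.
pose A := @closure_algorithm _ V item_of k a q k0 a_gt0 W F p.
exists (2 * (#|V| * (2 + a + x * k * a))).
  rewrite leq_mul2l /=; apply: leq_mul => //.
  apply: (@leq_trans ((3 + x * k) * a)); first by rewrite mulnDl; lia.
  by rewrite leq_mul2l aalpha orbT.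
(* The factor [2] comes from [#|V|.+2 <= n.+1 ^ 2], valid for [0 < #|V| <= 2 * n]. *)
have card_le : #|closure_state V k a W| <= n.+1 ^ (2 * (#|V| * (2 + a + x * k * a))).
  apply: (leq_trans (card_closure_state k aV Wx)); rewrite (expnM n.+1).
  have : 0 < #|V| by exact: leq_trans aV.
  by move=> V0; apply: leq_expl; nia.
have [f [g fg]] := memory_embedding (start A) card_le.
have [B BE] := algorithm_transport ans A fg; exists B => X s prX Xa strm.
rewrite BE; apply: ansP => //; first exact: stream_admissible strm.
move=> u v; apply/esym; apply: (closure_algorithmP _ _ q0 Fmin _ strm).
  exact: leq_trans V2n kn.
rewrite leq_min (leq_trans (parP _ (stream_admissible strm)) Xa) /=.
by apply/bigmax_leqP => S _; exact: max_card.
Qed.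

(** * Real estimates of the branching factor and the space *)

Section RealBounds.
Import Order.TTheory GRing.Theory Num.Theory.
Local Open Scope ring_scope.
Variable R : realType.

(** Take [k] just above the [q]-th root of [2 * n + 1], which is at most [4 * n]; the root of [4]
    costs a factor at most [4], and rounding up adds at most one. *)
Lemma ceil_root (n q : nat) : (0 < q)%N ->
  exists k, [/\ (0 < k)%N, (2 * n < k ^ q)%N &
    (0 < n)%N -> k%:R <= 5%:R * n%:R `^ (1 / q%:R) :> R].
Proof.
move=> q0; have [->|n0] := posnP n; first by exists 1%N; split; rewrite ?exp1n.
have qR : q%:R != 0 :> R by rewrite pnatr_eq0 -lt0n.
have n1 : 1 <= n%:R :> R by rewrite ler1n.
have e0 : 0 <= 1 / q%:R :> R by rewrite divr_ge0.
have e1 : 1 / q%:R <= 1 :> R by rewrite ler_pdivrMr ?ltr0n // mul1r ler1n.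
set y : R := (2 * n).+1%:R `^ (1 / q%:R); exists (Num.trunc y).+1; split=> //.
  rewrite -(ltr_nat R) natrX; apply: (@le_lt_trans _ _ (y ^+ q)).
    rewrite -powR_mulrn ?powR_ge0 // -powRrM mul1r mulVf // powRr1 // ler_nat.
    by lia.
  by rewrite ltrXn2r ?powR_ge0 ?truncnS_gt // -lt0n.
move=> _; have root1 : 1 <= n%:R `^ (1 / q%:R) :> R.
  by rewrite -{1}(powRr0 n%:R); exact: ler_powR.
have y_le : y <= 4%:R * n%:R `^ (1 / q%:R).
  apply: (@le_trans _ _ ((4%:R * n%:R) `^ (1 / q%:R))).
    apply: ge0_ler_powR => //; rewrite ?nnegrE //.
      by rewrite mulr_ge0.
    by rewrite -natrM ler_nat; lia.
  rewrite powRM // ler_wpM2r ?powR_ge0 // -{2}(powRr1 (_ : 0 <= 4%:R)) //.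
  by apply: ler_powR; rewrite ?ler1n.
have : (Num.trunc y)%:R <= y by rewrite truncn_le powR_ge0.
rewrite -natr1; lra.
Qed.

(** The witness is the integer square root, and [q + 1 <= 2 * q]. *)
Lemma floor_sqrt (p : nat) : (0 < p)%N ->
  exists q, [/\ (0 < q)%N, (q <= p %/ q)%N & Num.sqrt p%:R <= 2%:R * q%:R :> R].
Proof.
move=> p0.
have ex : exists q, (q * q <= p)%N by exists 1%N.
have ub q : (q * q <= p)%N -> (q <= p)%N by nia.
case: (ex_maxnP ex ub) => q qq qmax.
have q0 : (0 < q)%N by exact: (qmax 1%N).
have lt : (p < q.+1 * q.+1)%N by rewrite ltnNge; apply/negP => /qmax; rewrite ltnn.
exists q; split=> //; first by rewrite leq_divRL.
rewrite -(@ger0_norm _ (2%:R * q%:R)) ?mulr_ge0 // -sqrtr_sqr.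
apply: ler_wsqrtr; rewrite -natrM -natrX ler_nat; nia.
Qed.

Lemma solvable_bounds (P : problem) : (forall n, closure_determined P n) ->
  (exists C : R, forall p n alpha : nat, (0 < p)%N ->
     solvable_in_space InsertionOnly P p n alpha
       (C * alpha%:R * n%:R `^ (1 + 1 / p%:R))) /\
  (exists C c : R, forall p n alpha : nat, (0 < p)%N ->
     solvable_in_space Turnstile P p n alpha
       (C * alpha%:R * n%:R `^ (1 + c / Num.sqrt p%:R))).
Proof.
move=> Pdet; split.
  exists 80%:R => p n alpha p0; have [k [k0 kn kR]] := ceil_root n p0.
  have [||N _|S Sle SP] := @closure_solvable InsertionOnly P n p alpha k 1 1
    (Pdet n) k0.
  - by [].
  - by rewrite divn1 ltnW.
  - exists 'I_N.+2, (insertion_finder N.+1).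
    by split; [exact: insertion_finderP | rewrite card_ord].
  exists S; split => //.
  have [n0|n0] := posnP n.
    have -> : S = 0%N by apply/eqP; rewrite -leqn0; move: Sle; rewrite n0; lia.
    by rewrite !mulr_ge0 ?powR_ge0.
  have nz : n%:R != 0 :> R by rewrite pnatr_eq0 -lt0n.
  rewrite powRD ?nz ?implybT // powRr1 //; have := kR n0.
  set y := n%:R `^ _ => ky.
  (* From [3 + k <= 4 * k]; the factor [5] of [ceil_root] makes this [80]. *)
  have S1 : (S <= 16 * (alpha * n) * k)%N by nia.
  apply: (@le_trans _ _ (16 * (alpha * n) * k)%:R); first by rewrite ler_nat.
  have -> : 80%:R * alpha%:R * (n%:R * y) = (16 * (alpha * n))%:R * (5%:R * y) :> R.
    by rewrite !natrM; ring.
  by rewrite natrM ler_wpM2l.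
(* Here [500] is [20 * 5 ^ 2], and [c = 4] since [2 / q] is at most [4] over the square root of
   [p]. *)
exists 500%:R, 4%:R => p n alpha p0.
have [q [q0 qp pq]] := floor_sqrt p0; have [k [k0 kn kR]] := ceil_root n q0.
have [||N N2|S Sle SP] := @closure_solvable Turnstile P n p alpha k q k.+1
  (Pdet n) k0.
- by [].
- by apply: leq_trans (ltnW kn) _; apply: leq_pexp2l.
- exists (search_state k.-1 N N), (search_finder k.-1 N N q); split.
    by apply: search_finderP => //; rewrite prednK //; exact: leq_ltn_trans kn.
  (* A finder stores one quotient and [k] counters, hence [k.+1] words. *)
  rewrite card_prod card_option card_ffun !card_ord prednK // expnS.
  by rewrite leq_mul2l /=; apply: leq_expl.
exists S; split => //.
have [n0|n0] := posnP n.
  have -> : S = 0%N by apply/eqP; rewrite -leqn0; move: Sle; rewrite n0; lia.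
  by rewrite !mulr_ge0 ?powR_ge0.
have nz : n%:R != 0 :> R by rewrite pnatr_eq0 -lt0n.
rewrite powRD ?nz ?implybT // powRr1 //.
have S1 : (S <= 20 * (alpha * n) * k ^ 2)%N by nia.
apply: (@le_trans _ _ (20 * (alpha * n) * k ^ 2)%:R); first by rewrite ler_nat.
have qR : q%:R != 0 :> R by rewrite pnatr_eq0 -lt0n.
have y_le : (n%:R `^ (1 / q%:R)) ^+ 2 <= n%:R `^ (4%:R / Num.sqrt p%:R) :> R.
  rewrite -powR_mulrn ?powR_ge0 // -powRrM; apply: ler_powR; first by rewrite ler1n.
  have sp : 0 < Num.sqrt p%:R :> R by rewrite sqrtr_gt0 ltr0n.
  rewrite ler_pdivlMr // mul1r -mulrA ler_pdivrMl ?ltr0n //; lra.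
apply: (@le_trans _ _ ((20 * (alpha * n))%:R * (25%:R * (n%:R `^ (1 / q%:R)) ^+ 2))).
  rewrite natrM ler_wpM2l // natrX.
  have -> : 25%:R * (n%:R `^ (1 / q%:R)) ^+ 2 = (5%:R * n%:R `^ (1 / q%:R)) ^+ 2 :> R.
    by rewrite exprMn -natrX.
  by apply: lerXn2r; rewrite ?nnegrE ?mulr_ge0 ?powR_ge0 //; exact: kR.
have -> : 500%:R * alpha%:R * (n%:R * n%:R `^ (4%:R / Num.sqrt p%:R)) =
    (20 * (alpha * n))%:R * (25%:R * n%:R `^ (4%:R / Num.sqrt p%:R)) :> R.
  by rewrite !natrM; ring.
by rewrite ler_wpM2l // ler_wpM2l.
Qed.

End RealBounds.

(** * The four problems *)

Lemma arc_graph_id (n : nat) (X : digraph 'I_n) :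
  (forall e, e \in X -> e.1 != e.2) -> arc_graph id X = X.
Proof.
move=> irr; apply/setP => e; rewrite inE andbC.
by case: (boolP (e \in X)) => // /irr ->.
Qed.

Lemma digraph_closure_determined (ans : nat -> Type)
    (prom : forall n, digraph 'I_n -> Prop)
    (corr : forall n, digraph 'I_n -> ans n -> Prop) (n : nat) :
  (forall T : rel 'I_n, exists a, forall X : digraph 'I_n,
     prom n X -> connect (arc X) =2 T -> corr n X a) ->
  closure_determined (digraph_problem prom corr) n.
Proof.
move=> sol; exists 'I_n, id; split; first by rewrite card_ord leq_pmull.
  move=> T; have [a aP] := sol T; exists a => X irr prX.
  by rewrite arc_graph_id //; exact: aP.
by move=> X irr; rewrite arc_graph_id.
Qed.

Lemma acyclic_arc (V : finType) (G : digraph V) (u v : V) :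
  acyclic G -> arc G u v -> ~~ connect (arc G) v u.
Proof.
move=> acG uv; apply/negP => /connectP [p0 /shortenP [p vp up _] e].
suff: v :: p = [::] by [].
by apply: acG; rewrite /ucycle /= rcons_path vp -e uv.
Qed.

(** Sort by the number of ancestors: if the head of an arc came first, [rank_comparable] would make
    it reach the tail, closing a cycle. *)
Lemma topological_ordering_determined (n : nat) :
  closure_determined topological_ordering_problem n.
Proof.
apply: digraph_closure_determined => T.
pose le := relpre (rank T) leq; exists (sort le (enum 'I_n)) => X acX XT; split.
  by rewrite perm_sort.
move=> u v uv; rewrite ltnNge; apply/negP => leI.
have Tr : reflexive T by move=> x; rewrite -XT connect0.
have Tt : transitive T by move=> y x z; rewrite -!XT; exact: connect_trans.
have le_trans : transitive le by move=> y x z; exact: leq_trans.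
have le_sorted : sorted le (sort le (enum 'I_n)).
  by apply: sort_sorted => x y; exact: leq_total.
have : le v u.
  apply: (sorted_leq_index le_trans _ le_sorted) leI; rewrite ?mem_sort ?mem_enum //.
  by move=> x; exact: leqnn.
move/(rank_comparable Tr Tt); rewrite -!XT (connect1 uv) orbT => /(_ isT).
by apply/negP; exact: acyclic_arc.
Qed.

Lemma scc_determined (n : nat) : closure_determined scc_problem n.
Proof.
apply: digraph_closure_determined => T.
exists [set [set v | T u v && T v u] | u : 'I_n] => X _ XT.
by apply: eq_imset => u; apply/setP => v; rewrite !inE !XT.
Qed.

Lemma minimum_chain_cover_exists (V : finType) (G : digraph V) :
  exists cs, minimum_chain_cover G cs.
Proof.
have ex : exists m, `[< exists2 cs, chain_cover G cs & size cs = m >].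
  exists (size [seq [:: v] | v <- enum V]); apply/asboolP.
  exists [seq [:: v] | v <- enum V] => //; apply/and3P; split.
  - by apply/allP => _ /mapP [v _ ->].
  - by apply/mapP => -[v].
  by rewrite flatten_seq1.
case: (ex_minnP ex) => _ /asboolP [cs csG <-] csmin; exists cs; split=> // ds dsG.
by apply: csmin; apply/asboolP; exists ds.
Qed.

(** Chain covers depend on the transitive closure only, so an optimal cover of any digraph [X0] with
    closure [T] serves for all of them. *)
Lemma minimum_chain_cover_determined (n : nat) :
  closure_determined minimum_chain_cover_problem n.
Proof.
apply: digraph_closure_determined => T.
have [[X0 X0T]|no] := pselect (exists X0 : digraph 'I_n, connect (arc X0) =2 T);
    last by exists [::] => X _ XT; case: no; exists X.
have [cs csP] := minimum_chain_cover_exists X0; exists cs => X _ XT.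
have tcE : transitive_closure X = transitive_closure X0.
  by apply/setP => e; rewrite !inE XT X0T.
have ccE ds : chain_cover X ds = chain_cover X0 ds.
  by rewrite /chain_cover /chain tcE.
case: csP => csX0 csmin; split; first by rewrite ccE.
by move=> ds; rewrite ccE; exact: csmin.
Qed.

(** * 2-SAT as reachability among literals *)

Definition holds (n : nat) (a : {ffun 'I_n -> bool}) (l : literal n) : bool :=
  a l.1 == l.2.

Lemma holds_neg (n : nat) (a : {ffun 'I_n -> bool}) (l : literal n) :
  holds a (neg l) = ~~ holds a l.
Proof. by rewrite /holds /=; case: (a l.1); case: l.2. Qed.

Lemma negK (n : nat) (l : literal n) : neg (neg l) = l.
Proof. by case: l => x b; rewrite /neg /= negbK. Qed.

(** The arcs of a clause say that its second literal holds whenever the first fails, so satisfaction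
    means that the true literals are closed under reachability. *)
Lemma satisfies_closed (n : nat) (a : {ffun 'I_n -> bool})
    (F : {set {set literal n}}) :
  (forall c, c \in F -> is_clause c) ->
  satisfies a F <-> (forall u v, connect (arc (implication_graph F)) u v ->
                       holds a u -> holds a v).
Proof.
move=> clF; split=> [/forall_inP sat u v /connectP [p]|closed].
  elim: p u => [|w p IH] u /=; first by move=> _ ->.
  case/andP=> uw wp e au; apply: (IH w) => //.
  move: uw; rewrite /arc /= inE /= => /andP [_ /sat /exists_inP [l]].
  rewrite !inE => /orP [] /eqP ->; last by [].
  by rewrite -[_ == _]/(holds a (neg u)) holds_neg au.
apply/forall_inP => c cF; have /existsP [l /existsP [l' /eqP cE]] := clF c cF.
have [al|nal] := boolP (holds a l).
  by apply/exists_inP; exists l => //; rewrite cE !inE eqxx.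
apply/exists_inP; exists l'; first by rewrite cE !inE eqxx orbT.
(* The omitted loops belong to tautological clauses. *)
have [<-|ne] := eqVneq (neg l) l'; first by rewrite -[_ == _]/(holds _ _) holds_neg.
apply: (closed (neg l)); last by rewrite holds_neg.
by apply: connect1; rewrite /arc /= inE /= ne negK -cE.
Qed.

Lemma two_sat_determined (n : nat) : closure_determined two_sat_problem n.
Proof.
exists (literal n), (fun e => [set neg e.1; e.2]); split=> //.
  by rewrite card_prod card_ord card_bool mulnC.
move=> T.
have [[a aP]|no] := pselect (exists a : {ffun 'I_n -> bool},
    forall u v, T u v -> holds a u -> holds a v).
  exists (Some a) => F clF _ FT; apply/(satisfies_closed _ clF) => u v.
  by rewrite [connect _ _ _]FT; exact: aP.
exists None => F clF _ FT a; apply/negP => /(satisfies_closed _ clF) cl.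
by apply: no; exists a => u v; rewrite -FT; exact: cl.
Qed.

Local Open Scope ring_scope.

Theorem theorem6p21 (R : realType) (P : problem)
    (hP : [\/ P = topological_ordering_problem, P = scc_problem,
              P = minimum_chain_cover_problem | P = two_sat_problem]) :
  (exists C : R, forall p n alpha : nat, (0 < p)%N ->
     solvable_in_space InsertionOnly P p n alpha
       (C * alpha%:R * n%:R `^ (1 + 1 / p%:R))) /\
  (exists C c : R, forall p n alpha : nat, (0 < p)%N ->
     solvable_in_space Turnstile P p n alpha
       (C * alpha%:R * n%:R `^ (1 + c / Num.sqrt p%:R))).
Proof.
apply: solvable_bounds => n; case: hP => ->.
- exact: topological_ordering_determined.
- exact: scc_determined.
- exact: minimum_chain_cover_determined.
exact: two_sat_determined.
Qed.
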